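(* Let $q\in\mathbb{C}$ with $|q|\le 1$, let $A$ be a positive (semidefinite) $n\times n$ complex matrix with $m=\dim(R(A^{1/2}))$, $2\le m\le n$, and let $T$ be an $n\times n$ complex $A$-self-adjoint matrix. Then $T$ has $m$ $A$-eigenvalues $\lambda_1\ge\lambda_2\ge\cdots\ge\lambda_m$ (real, counted with multiplicity), and $W_{q,A}(T)$ is the closed elliptic disk with foci $q\lambda_1$ and $q\lambda_m$ and minor axis of length $\sqrt{1-|q|^2}\,(\lambda_1-\lambda_m)$.
   Context: On $\mathbb{C}^n$ with standard inner product $\langle\cdot,\cdot\rangle$ put $\langle x,y\rangle_A=\langle Ax,y\rangle$ and $\|x\|_A=\sqrt{\langle x,x\rangle_A}$. $R(\cdot)$ denotes range. $T$ is $A$-self-adjoint if $AT=T^*A$. The $A$-eigenvalues of $T$ are the elements of $\sigma_{A_p}(T)=\{\lambda\in\mathbb{C}:\exists\,x\in R(A),\ x\ne 0,\ ATx=\lambda Ax\}$; the multiplicity of $\lambda$ is $\dim\{x\in R(A):ATx=\lambda Ax\}$. The $A$-$q$-numerical range is $W_{q,A}(T)=\{\langle Tx,y\rangle_A: x,y\in\mathbb{C}^n,\ \|x\|_A=\|y\|_A=1,\ \langle x,y\rangle_A=q\}$. The closed elliptic disk with foci $f_1,f_2\in\mathbb{C}$ and minor axis of length $\ell\ge 0$ is $\{z\in\mathbb{C}:|z-f_1|+|z-f_2|\le\sqrt{|f_1-f_2|^2+\ell^2}\}$ (degenerate cases, i.e. segments or points, allowed). *)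

(* Defs.v *)
From HB Require Import structures.
From mathcomp Require Import all_boot all_order all_algebra.
From mathcomp Require Import sesquilinear spectral.
From mathcomp Require Import complex ring.
From mathcomp Require Import classical_sets reals.
Set Implicit Arguments.
Unset Strict Implicit.
Unset Printing Implicit Defensive.
Import Order.TTheory GRing.Theory Num.Theory.
Local Open Scope ring_scope.
Local Open Scope sesquilinear_scope.

Section SemiInnerProduct.
Context {C : numClosedFieldType} {n : nat}.
Implicit Types (A T : 'M[C]_n) (x y z : 'cV[C]_n) (l q : C).

(* dotmx lives on row vectors and is conjugate-linear in its second argument *)
Definition dotc x y : C := dotmx x^T y^T.

Lemma dotcE x y : dotc x y = \sum_(i < n) x i 0 * (y i 0)^*.
Proof. by rewrite /dotc dotmxE mxE; apply: eq_bigr => i _; rewrite !mxE. Qed.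

(* On C, 0 <= z means that z is real and nonnegative. *)
Definition psdmx A : Prop := forall x, 0 <= dotc (A *m x) x.

(* The positive square root A^(1/2) of a positive A, through the spectral
   decomposition A = P^-1 *m diag_mx d *m P; see sqrtmx_psd and sqrtmxK. *)
Definition sqrtmx A : 'M[C]_n :=
  invmx (spectralmx A) *m diag_mx (map_mx sqrtC (spectral_diag A))
    *m spectralmx A.

Definition mxrange A : {vspace 'cV[C]_n} := limg (linfun (mulmx A)).

Definition dotA A x y : C := dotc (A *m x) y.

Definition normA A x : C := sqrtC (dotA A x x).

Definition Aselfadjoint A T : Prop := A *m T = T^t* *m A.

Definition Aeigenvalues A T : set C :=
  [set l | exists x, [/\ x \in mxrange A, x != 0
                       & A *m (T *m x) = l *: (A *m x)]]%classic.

Definition Aeigenspace A T l : {vspace 'cV[C]_n} :=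
  (mxrange A :&: lker (linfun (mulmx (A *m T - l *: A))))%VS.

Definition Amultiplicity A T l : nat := \dim (Aeigenspace A T l).

Definition Aqnumrange q A T : set C :=
  [set z | exists x y, [/\ normA A x = 1, normA A y = 1, dotA A x y = q
                         & z = dotA A (T *m x) y]]%classic.

Lemma mem_mxrangeP A x : reflect (exists z, x = A *m z) (x \in mxrange A).
Proof.
apply: (iffP memv_imgP) => [[z _ ->]|[z ->]]; exists z; rewrite ?lfunE //.
exact: memvf.
Qed.

Lemma mem_AeigenspaceE A T l x :
  (x \in Aeigenspace A T l)
    = (x \in mxrange A) && (A *m (T *m x) == l *: (A *m x)).
Proof.
rewrite memv_cap memv_ker lfunE /= mulmxBl -mulmxA -scalemxAl.
by rewrite subr_eq0.
Qed.

End SemiInnerProduct.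

Section EllipticDisk.
Context {C : numClosedFieldType}.

(* Foci f1, f2; len is the full (not half) length of the minor axis, a
   nonnegative real number, so that both sides of <= are real. *)
Definition elliptic_disk (f1 f2 len : C) : set C :=
  [set z | `|z - f1| + `|z - f2| <= sqrtC (`|f1 - f2| ^+ 2 + len ^+ 2)]%classic.

End EllipticDisk.

Section SquareRoot.
Context {C : numClosedFieldType} {n : nat}.
Implicit Types (A : 'M[C]_n) (x y : 'cV[C]_n).

Lemma dotc_mx A x y : dotc (A *m x) y = (y^t* *m A *m x) 0 0.
Proof.
rewrite dotcE -mulmxA mxE; apply: eq_bigr => i _.
by rewrite !mxE mulrC.
Qed.

Lemma psdmx_hermsym A : psdmx A -> A \is hermsymmx.
Proof.
move=> psdA; apply/is_hermitianmxP; rewrite expr0 scale1r.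
pose f x y : C := dotc (A *m x) y.
have fD x y z : f (x + y) z = f x z + f y z.
  by rewrite /f !dotc_mx mulmxDr mxE.
have fDr x y z : f z (x + y) = f z x + f z y.
  by rewrite /f !dotc_mx linearD map_mxD !mulmxDl mxE.
have fZ a x z : f (a *: x) z = a * f x z.
  by rewrite /f !dotc_mx -scalemxAr mxE.
have fZr a x z : f z (a *: x) = a^* * f z x.
  by rewrite /f !dotc_mx linearZ map_mxZ /= -!scalemxAl mxE.
have fR x : (f x x)^* = f x x by apply/CrealP/ger0_real/psdA.
have fE x y : f x y = (f y x)^*.
  have h1 := fR (x + y); have h2 := fR (x + 'i *: y).
  rewrite !(fD, fDr, fZ, fZr, rmorphD, rmorphM, rmorphN) /= in h1 h2.
  rewrite !fR !(conjCi, rmorphN, conjCK) /= in h1 h2.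
  have i2 : 'i * 'i = -1 :> C by rewrite -expr2 sqrCi.
  move: h1 h2; move: (f x x) (f y y) (f x y) (f y x) (_^*) (_^*).
  move=> a b c d c' d' h1 h2.
  have e0 : (c - c') * 2%:R = (a + c + (d + b) - (a + d' + (c' + b)))
      + 'i * (a + - 'i * c + ('i * d + 'i * (- 'i * b))
              - (a + 'i * d' + (- 'i * c' + - 'i * ('i * b))))
      + ('i * 'i + 1) * (c + d' - d - c') by ring.
  move: e0; rewrite h1 h2 i2 addNr !subrr mulr0 mul0r !addr0 => /eqP.
  by rewrite mulf_eq0 pnatr_eq0 orbF subr_eq0 => /eqP.
pose e := fun i : 'I_n => delta_mx i 0 : 'cV[C]_n.
have fe i j : f (e j) (e i) = A i j.
  rewrite /f dotcE (bigD1 i) //= big1 => [|k ki]; last first.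
    by rewrite !mxE (negPf ki) conjC0 mulr0.
  by rewrite /e -colE !mxE !eqxx conjC1 mulr1 addr0.
by apply/matrixP => i j; rewrite !mxE -!fe.
Qed.

Lemma dotc_diag (P : 'M[C]_n) (d : 'rV[C]_n) x :
  dotc (P^t* *m diag_mx d *m P *m x) x
    = \sum_(i < n) d 0 i * `|(P *m x) i 0| ^+ 2.
Proof.
have -> : dotc (P^t* *m diag_mx d *m P *m x) x
    = ((P *m x)^t* *m (diag_mx d *m (P *m x))) 0 0.
  by rewrite dotc_mx trmx_mul map_mxM !mulmxA.
rewrite mxE; apply: eq_bigr => i _.
by rewrite mul_diag_mx !mxE normCK mulrC mulrA.
Qed.

Lemma psdmx_spectral_ge0 A i : psdmx A -> 0 <= spectral_diag A 0 i.
Proof.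
move=> psdA; have /hermitian_normalmx/orthomx_spectralP := psdmx_hermsym psdA.
set P := spectralmx A; set d := spectral_diag A => AE.
have uP : P \is unitarymx := spectral_unitarymx A.
have := psdA (P^t* *m delta_mx i 0).
rewrite [A in dotc (A *m _)]AE invmx_unitary // dotc_diag mulmxA.
rewrite (unitarymxP uP) mul1mx (bigD1 i) //= big1 => [|k ki]; last first.
  by rewrite !mxE (negPf ki) normr0 expr0n mulr0.
by rewrite !mxE !eqxx normr1 expr1n mulr1 addr0.
Qed.

Lemma sqrtmx_psd A : psdmx A -> psdmx (sqrtmx A).
Proof.
move=> psdA x; rewrite /sqrtmx invmx_unitary ?spectral_unitarymx // dotc_diag.
apply: sumr_ge0 => i _; rewrite mulr_ge0 ?exprn_ge0 //.
by rewrite mxE sqrtC_ge0 psdmx_spectral_ge0.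
Qed.

Lemma sqrtmxK A : psdmx A -> sqrtmx A *m sqrtmx A = A.
Proof.
move=> psdA; have /hermitian_normalmx/orthomx_spectralP := psdmx_hermsym psdA.
move=> AE; rewrite [RHS]AE /sqrtmx !mulmxA mulmxK ?spectral_unit //.
congr (_ *m _); rewrite -!mulmxA mulmx_diag; congr (_ *m diag_mx _).
by apply/rowP => i; rewrite !mxE -expr2 sqrtCK.
Qed.
End SquareRoot.

(* Main.v *)
Require Import Defs.
From HB Require Import structures.
From mathcomp Require Import all_boot all_order all_algebra perm.
From mathcomp Require Import sesquilinear spectral complex ring.
From mathcomp Require Import classical_sets reals.
Import Order.TTheory GRing.Theory Num.Theory.
Local Open Scope ring_scope.
Local Open Scope complex_scope.

(** The semidefinite form [<x, y>_A] only sees the range of [A], on which it is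
    positive definite, and [A *m T] is Hermitian because [T] is
    [A]-self-adjoint.  So the pencil [(A *m T, A)] can be diagonalized
    simultaneously: there is an [A]-orthonormal basis [V] of the range of [A],
    with [m] columns, such that [A *m T *m V = A *m V *m diag_mx l] for real
    numbers [l] in decreasing order ([A_eigenbasis]).  It is obtained by
    normalizing an arbitrary basis with the inverse square root of its Gram
    matrix ([A_orthonormal_basis]) and then rotating it by a unitary matrix that
    diagonalizes the compression of [A *m T].

    In the coordinates [V^t* *m A *m x], the form [<x, y>_A] is the standard
    inner product of ['cV_m] and [<T x, y>_A] is [\sum_i l_i x_i y_i^*]; hence
    the [A]-eigenvalues, with their multiplicities, are the [l_i], and the
    [A]-[q]-numerical range is that of a real diagonal matrix.

    Since [|q|^2 d^2 + (1 - |q|^2) d^2 = d^2] for [d = l_0 - l_(m-1)], the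
    elliptic disk is [|z - q l_0| + |z - q l_(m-1)| <= d].  For unit vectors
    [x] and [y] with [<x, y> = q], the two distances are at most
    [\sum_i (l_0 - l_i) |x_i y_i|] and [\sum_i (l_i - l_(m-1)) |x_i y_i|], which
    add up to [d \sum_i |x_i y_i| <= d].  Conversely, a point [z] of the disk is
    [l_0 a + l_(m-1) b] with [a + b = q] and [|a| + |b| <= 1], and such [a]
    and [b] are the products [x_0 y_0^*] and [x_1 y_1^*] for two unit vectors
    [x] and [y] of the plane ([unit_pairs]); placing these on the two extreme
    coordinates gives [z] ([diag_qnumrange]). *)

(** * Scalar lemmas *)

Section Scalars.
Context {C : numClosedFieldType}.
Implicit Types a b : C.

(** The real core of [unit_pairs]: [u] and [v] are the squared moduli of the
    first coordinates of the two unit vectors.  The two equations prescribe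
    the sum [s = 1 + a^2 - b^2] and the product [a^2] of [u] and [v], so these
    are the roots of a quadratic whose discriminant factors as a product of four
    terms that are nonnegative when [a + b <= 1]. *)
Lemma ge0_weights a b : 0 <= a -> 0 <= b -> a + b <= 1 ->
  exists u v, [/\ 0 <= u <= 1, 0 <= v <= 1,
                  u * v = a ^+ 2 & (1 - u) * (1 - v) = b ^+ 2].
Proof.
move=> a0 b0 ab1.
have a1 : a <= 1 by apply: le_trans ab1; rewrite lerDl.
have b1 : b <= 1 by apply: le_trans ab1; rewrite lerDr.
pose s := 1 + a ^+ 2 - b ^+ 2; pose d := sqrtC (s ^+ 2 - 4 * a ^+ 2).
have d0 : 0 <= s ^+ 2 - 4 * a ^+ 2.
  rewrite (_ : _ - _
    = (1 - (a + b)) * (1 - a + b) * ((1 - b + a) * (1 + a + b)));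
    last by rewrite /s; ring.
  have [a1' b1'] : 0 <= 1 - a /\ 0 <= 1 - b by rewrite !subr_ge0.
  by rewrite !mulr_ge0 // ?subr_ge0 // addr_ge0 // addr_ge0 ?ler01.
have ds : d ^+ 2 = s ^+ 2 - 4 * a ^+ 2 by rewrite /d sqrtCK.
have dge0 : 0 <= d by rewrite sqrtC_ge0.
have s0 : 0 <= s by rewrite /s addrAC addr_ge0 ?exprn_ge0 ?subr_ge0 ?exprn_ile1.
have s2 : 0 <= 2 - s.
  rewrite (_ : 2 - s = (1 - a ^+ 2) + b ^+ 2); last by rewrite /s; ring.
  by rewrite addr_ge0 ?exprn_ge0 ?subr_ge0 ?exprn_ile1.
have les : d <= s.
  rewrite -(@ler_pXn2r _ 2) ?nnegrE // ds lerBlDr lerDl.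
  by rewrite mulr_ge0 ?exprn_ge0 ?ler0n.
have les2 : d <= 2 - s.
  rewrite -(@ler_pXn2r _ 2) ?nnegrE // ds -subr_ge0.
  rewrite (_ : _ - _ = 4 * b ^+ 2); last by rewrite /s; ring.
  by rewrite mulr_ge0 ?exprn_ge0 ?ler0n.
have p2 : 0 < (2 : C) by rewrite ltr0n.
exists ((s + d) / 2), ((s - d) / 2); split.
- apply/andP; split; first by rewrite (divr_ge0 (addr_ge0 s0 dge0) (ltW p2)).
  by rewrite ler_pdivrMr // mul1r addrC -lerBrDr.
- apply/andP; split; first by apply: divr_ge0 (ltW p2); rewrite subr_ge0.
  rewrite ler_pdivrMr // mul1r.
  by rewrite lerBlDr (@le_trans _ _ 2) ?lerDl // -subr_ge0.
- by rewrite mulf_div [(s + d) * _]mulrC -subr_sqr ds; field.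
rewrite (_ : _ * _ = ((2 - s) ^+ 2 - d ^+ 2) / 4); last by field.
by rewrite ds /s; field.
Qed.

(** Absorbs the argument of [a] into the second factor, which is conjugated as
    in the second variable of the inner product. *)
Lemma factor_with_norms a (r s : C) : 0 <= r -> 0 <= s -> r * s = `|a| ->
  exists y, `|y| = s /\ r * y^* = a.
Proof.
move=> r0 s0 rs; have [a0|a0] := eqVneq a 0.
  exists s; split; first by rewrite ger0_norm.
  by rewrite (CrealP (ger0_real s0)) rs a0 normr0.
exists (s * (a / `|a|)^*); split.
  rewrite normrM norm_conjC normf_div normr_id divff ?normr_eq0 // mulr1.
  exact: ger0_norm.
rewrite rmorphM /= conjCK (CrealP (ger0_real s0)) mulrA rs mulrC divfK //.
by rewrite normr_eq0.
Qed.

(** Two unit vectors of the plane can have any prescribed coordinatewise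
    products, as far as the Cauchy-Schwarz bound allows. *)
Lemma unit_pairs a b : `|a| + `|b| <= 1 ->
  exists x1 x2 y1 y2, [/\ `|x1| ^+ 2 + `|x2| ^+ 2 = 1 :> C,
    `|y1| ^+ 2 + `|y2| ^+ 2 = 1 :> C, x1 * y1^* = a & x2 * y2^* = b].
Proof.
move=> /(ge0_weights _ _ (normr_ge0 _) (normr_ge0 _)).
move=> [u [v [/andP[u0 u1] /andP[v0 v1] uv uv']]].
have u1' : 0 <= 1 - u by rewrite subr_ge0.
have v1' : 0 <= 1 - v by rewrite subr_ge0.
have [|||y1 [n1 e1]] := factor_with_norms a (sqrtC u) (sqrtC v);
  rewrite ?sqrtC_ge0 //.
  by rewrite -sqrtCM ?nnegrE // uv sqrCK ?normr_ge0.
have [|||y2 [n2 e2]] := factor_with_norms b (sqrtC (1 - u)) (sqrtC (1 - v));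
  rewrite ?sqrtC_ge0 //.
  by rewrite -sqrtCM ?nnegrE // uv' sqrCK ?normr_ge0.
exists (sqrtC u), (sqrtC (1 - u)), y1, y2; split=> //.
  by rewrite !ger0_norm ?sqrtC_ge0 // !sqrtCK addrC subrK.
by rewrite n1 n2 !sqrtCK addrC subrK.
Qed.

(** The lengths of the focal segment and of the minor axis are such that the
    major axis has length [l0 - l1], whatever [q] is. *)
Lemma elliptic_diskE (q l0 l1 : C) : `|q| <= 1 -> l1 <= l0 ->
  elliptic_disk (q * l0) (q * l1) (sqrtC (1 - `|q| ^+ 2) * (l0 - l1))
  = [set z | `|z - q * l0| + `|z - q * l1| <= l0 - l1]%classic.
Proof.
move=> q1 l10; rewrite /elliptic_disk.
have d0 : 0 <= l0 - l1 by rewrite subr_ge0.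
rewrite -mulrBr normrM (ger0_norm d0) !exprMn sqrtCK -mulrDl addrC subrK mul1r.
by rewrite sqrCK.
Qed.

End Scalars.

(** * The q-numerical range of a real diagonal matrix *)

Section DiagonalCase.
Context {C : numClosedFieldType} {m : nat}.
Implicit Types (lam : 'I_m -> C) (c e : 'cV[C]_m) (q z : C).

Lemma dotc_self c : dotc c c = \sum_i `|c i 0| ^+ 2.
Proof. by rewrite dotcE; apply: eq_bigr => i _; rewrite normCK. Qed.

Lemma sum_normM_le1 c e : dotc c c = 1 -> dotc e e = 1 ->
  \sum_i `|c i 0| * `|e i 0| <= 1.
Proof.
move=> c1 e1; rewrite -(ler_pM2r (ltr0n C 2)) mul1r mulr_suml.
rewrite [leRHS](_ : _ = dotc c c + dotc e e); last by rewrite c1 e1.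
rewrite !dotc_self -big_split /= ler_sum // => i _.
rewrite -subr_ge0 (_ : _ - _ = (`|c i 0| - `|e i 0|) ^+ 2); last by ring.
by rewrite real_exprn_even_ge0 // rpredB // normr_real.
Qed.

(** The triangle inequality applied to the distances to both foci yields a sum
    that telescopes, term by term, to [lam i0 - lam i1]; every point of the disk
    is reached by vectors supported on the two extreme coordinates. *)
Lemma diag_qnumrange lam (i0 i1 : 'I_m) q z : `|q| <= 1 -> i0 != i1 ->
    (forall i, lam i1 <= lam i <= lam i0) ->
  (exists c e, [/\ dotc c c = 1, dotc e e = 1, dotc c e = q
                 & z = \sum_i lam i * (c i 0 * (e i 0)^*)])
  <-> `|z - q * lam i0| + `|z - q * lam i1| <= lam i0 - lam i1.
Proof.
move=> q1 i01 lamP; have d0 : 0 <= lam i0 - lam i1.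
  by rewrite subr_ge0; case/andP: (lamP i0).
split=> [[c [e [c1 e1 <- ->]]]|zq].
  have focus (i : 'I_m) : \sum_j lam j * (c j 0 * (e j 0)^*) - dotc c e * lam i
      = \sum_j (lam j - lam i) * (c j 0 * (e j 0)^*).
    rewrite dotcE mulr_suml -sumrB; apply: eq_bigr => j _.
    by rewrite mulrBl [_ * lam i]mulrC.
  rewrite !focus.
  apply: le_trans (lerD (ler_norm_sum _ _ _) (ler_norm_sum _ _ _)) _.
  rewrite -big_split /= -[leRHS]mulr1.
  apply: le_trans (ler_wpM2l d0 (sum_normM_le1 _ _ c1 e1)).
  rewrite mulr_sumr ler_sum // => j _; case/andP: (lamP j) => l1 l0.
  rewrite !normrM norm_conjC -mulrDl distrC.
  have /ger0_norm -> : 0 <= lam i0 - lam j by rewrite subr_ge0.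
  have /ger0_norm -> : 0 <= lam j - lam i1 by rewrite subr_ge0.
  by rewrite addrA subrK.
(* a and b solve a + b = q and lam i0 * a + lam i1 * b = z; when the two
   eigenvalues coincide the disk is the point q * lam i0 and (q, 0) works. *)
pose d := lam i0 - lam i1.
have [a [b [ab abq abz]]] : exists a b, [/\ `|a| + `|b| <= 1, a + b = q
    & lam i0 * a + lam i1 * b = z].
  have [dz|dn0] := eqVneq d 0.
    exists q, 0; split; rewrite ?normr0 ?addr0 ?mulr0 //.
    move: zq; rewrite -/d dz => zq.
    have : `|z - q * lam i0| <= 0 by apply: le_trans zq; rewrite lerDl.
    by rewrite normr_le0 subr_eq0 addr0 mulrC => /eqP ->.
  exists ((z - q * lam i1) / d), ((q * lam i0 - z) / d); split.
  - rewrite !normf_div (ger0_norm d0) -mulrDl ler_pdivrMr ?lt_def ?dn0 //.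
    by rewrite mul1r addrC distrC.
  - by rewrite -mulrDl addrC subrKA -mulrBr mulfK.
  by rewrite /d; field.
have [x1 [x2 [y1 [y2 [x12 y12 e1 e2]]]]] := unit_pairs a b ab.
pose v (s t : C) : 'cV[C]_m :=
  \col_i (if i == i0 then s else if i == i1 then t else 0).
have sum2 (F : 'I_m -> C) : (forall i, i != i0 -> i != i1 -> F i = 0) ->
    \sum_i F i = F i0 + F i1.
  move=> F0; rewrite (bigD1 i0) //= (bigD1 i1) 1?eq_sym //= big1 ?addr0 //.
  by move=> i /andP[/F0 h /h].
have v0 s t : v s t i0 0 = s by rewrite mxE eqxx.
have v1 s t : v s t i1 0 = t by rewrite mxE eqxx eq_sym (negPf i01).
have vn s t i : i != i0 -> i != i1 -> v s t i 0 = 0.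
  by move=> h0 h1; rewrite mxE (negPf h0) (negPf h1).
exists (v x1 x2), (v y1 y2).
rewrite !dotc_self dotcE.
rewrite !sum2 ?v0 ?v1 ?e1 ?e2; first by split; rewrite ?abz.
all: by move=> i h0 h1; rewrite !vn // ?normr0 ?expr0n ?mul0r ?mulr0.
Qed.

End DiagonalCase.

(** * Spaces of column vectors and matrices *)

Section ColumnSpaces.
Context {F : fieldType}.

Lemma mulmx_cV_inj {m n} (M N : 'M[F]_(m, n)) :
  (forall x : 'cV_n, M *m x = N *m x) -> M = N.
Proof.
move=> MN; apply/matrixP => i j.
by have /matrixP/(_ i 0) := MN (delta_mx j 0); rewrite -!colE !mxE.
Qed.

Lemma unitmx_inj {m} (M : 'M[F]_m) :
  (forall c : 'cV_m, M *m c = 0 -> c = 0) -> M \in unitmx.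
Proof.
move=> injM; rewrite -unitmx_tr -row_free_unit -kermx_eq0.
apply/eqP/row_matrixP => i; rewrite row0; apply: trmx_inj; rewrite trmx0.
apply: injM; apply: trmx_inj.
by rewrite trmx_mul trmxK trmx0 -row_mul mulmx_ker row0.
Qed.

Lemma limg_mulmx_sub {m n} (V : 'M[F]_(n, m)) (U : {vspace 'cV[F]_n}) :
  (forall c : 'cV_m, V *m c \in U) -> (limg (linfun (mulmx V)) <= U)%VS.
Proof.
by move=> VU; apply/subvP => _ /memv_imgP[c _ ->]; rewrite lfunE /= VU.
Qed.

Lemma dim_limg_mulmx {m n} (V : 'M[F]_(n, m)) :
  (forall c : 'cV_m, V *m c = 0 -> c = 0) ->
  \dim (limg (linfun (mulmx V)) : {vspace 'cV_n}) = m.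
Proof.
move=> injV; rewrite limg_dim_eq.
  by rewrite dimvf dim_matrix; apply: muln1.
apply/eqP; rewrite -subv0; apply/subvP => c.
by rewrite memv_cap memv_ker lfunE /= => /andP[_ /eqP/injV ->]; rewrite mem0v.
Qed.

Lemma vspace_mx_basis {n} (U : {vspace 'cV[F]_n}) :
  exists K : 'M[F]_(n, \dim U), (forall c, K *m c \in U)
    /\ (forall c : 'cV_(\dim U), K *m c = 0 -> c = 0).
Proof.
pose K : 'M[F]_(n, \dim U) := \matrix_(i, j) (vbasis U)`_j i 0.
have KE (c : 'cV_(\dim U)) : K *m c = \sum_j c j 0 *: (vbasis U)`_j.
  apply/matrixP => i j; rewrite ord1 summxE mxE; apply: eq_bigr => k _.
  by rewrite !mxE mulrC.
exists K; split=> c; rewrite KE.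
  apply: memv_suml => i _; apply/memvZ/vbasis_mem/mem_nth.
  by rewrite size_tuple.
move=> c0; apply/matrixP => i j; rewrite ord1 mxE.
exact: (freeP (basis_free (vbasisP U)) (fun i => c i 0)).
Qed.

End ColumnSpaces.

(** * Orthonormal bases for a semidefinite form *)

Section AOrthonormalBasis.
Context {C : numClosedFieldType}.
Local Open Scope sesquilinear_scope.

Lemma adjmxM {m n p} (M : 'M[C]_(m, n)) (N : 'M[C]_(n, p)) :
  (M *m N)^t* = N^t* *m M^t*.
Proof. by rewrite trmx_mul map_mxM. Qed.

Lemma dotc_adj {n} (x y : 'cV[C]_n) : dotc x y = (y^t* *m x) 0 0.
Proof. by rewrite -[x in LHS]mul1mx dotc_mx mulmx1. Qed.

Lemma dotc_eq0 {n} (x : 'cV[C]_n) : dotc x x = 0 -> x = 0.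
Proof.
rewrite dotc_self => /eqP; rewrite psumr_eq0 => [/allP x0|i _]; last first.
  by rewrite exprn_ge0.
apply/matrixP => i j; rewrite ord1 mxE.
by have := x0 i (mem_index_enum _); rewrite /= expf_eq0 normr_eq0 => /eqP.
Qed.

(** [x^t* *m M^t* *m M *m x] is the squared norm of [M *m x]. *)
Lemma adjmx_mul_eq0 {m n} (M : 'M[C]_(m, n)) (x : 'cV[C]_n) :
  M^t* *m M *m x = 0 -> M *m x = 0.
Proof.
move=> MMx; apply: dotc_eq0.
by rewrite dotc_adj adjmxM -!mulmxA [M^t* *m _]mulmxA MMx mulmx0 mxE.
Qed.

Lemma psdmx_adj {n} (A : 'M[C]_n) : psdmx A -> A^t* = A.
Proof.
by move=> /psdmx_hermsym/is_hermitianmxP; rewrite expr0 scale1r => {2}->.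
Qed.

Lemma sqrtmx_adj {n} (A : 'M[C]_n) : psdmx A -> (sqrtmx A)^t* = sqrtmx A.
Proof. by move/sqrtmx_psd/psdmx_adj. Qed.

(** The Gram matrix [G] of a basis [K] of the range of [S] is invertible: if
    [G *m c = 0] then [S *m (K *m c) = 0], and a Hermitian [S] is injective on
    its own range.  So [K *m invmx (sqrtmx G)] is orthonormal.  The last
    conclusion says that [V *m V^t* *m A] is a projection onto the range of [A]
    modulo the kernel of [A]; it is Parseval's expansion in the basis [V]. *)
Lemma A_orthonormal_basis {n} (A S : 'M[C]_n) (m := \dim (mxrange S)) :
  psdmx A -> S *m S = A -> S^t* = S ->
  exists V : 'M[C]_(n, m), [/\ V^t* *m A *m V = 1%:M,
    (forall x, x \in mxrange A <-> exists c, x = V *m c)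
    & A *m V *m V^t* *m A = A].
Proof.
move=> psdA SS Sadj; have [K [KS injK]] := vspace_mx_basis (mxrange S).
rewrite -/m in K KS injK.
pose G := K^t* *m A *m K.
have GE : G = (S *m K)^t* *m (S *m K).
  by rewrite adjmxM Sadj !mulmxA -(mulmxA _ S S) SS.
have psdG : psdmx G.
  move=> c; rewrite dotc_mx /G !mulmxA -adjmxM -!mulmxA mulmxA -dotc_mx.
  exact: psdA.
have [N NN Nadj] : exists2 N, N *m N = G & N^t* = N.
  by exists (sqrtmx G); [apply: sqrtmxK | apply: sqrtmx_adj].
have Nu : N \in unitmx.
  apply: unitmx_inj => c Nc0; apply: injK.
  have SKc : S *m (K *m c) = 0.
    rewrite mulmxA; apply: adjmx_mul_eq0.
    by rewrite -GE -NN -mulmxA Nc0 mulmx0.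
  have /mem_mxrangeP[w Kw] := KS c.
  move: SKc; rewrite Kw -{1}Sadj mulmxA; exact: adjmx_mul_eq0.
pose V := K *m invmx N.
have VAV : V^t* *m A *m V = 1%:M.
  have iN : (invmx N)^t* *m N = 1%:M.
    by rewrite -{2}Nadj -adjmxM mulmxV // trmx1 map_mx1.
  rewrite /V adjmxM -!mulmxA !mulmxA -(mulmxA _ _ A) -(mulmxA _ _ K) -/G -NN.
  by rewrite mulmxA iN mul1mx mulmxV.
have VS c : V *m c \in mxrange S by rewrite /V -mulmxA KS.
clearbody V.
have injAV (c : 'cV_m) : A *m V *m c = 0 -> c = 0.
  by move=> c0; rewrite -[c]mul1mx -VAV -!mulmxA [A *m _]mulmxA c0 mulmx0.
have injV (c : 'cV_m) : V *m c = 0 -> c = 0.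
  by move=> c0; apply: injAV; rewrite -mulmxA c0 mulmx0.
(* V and A *m V are injective on a space of the dimension of the range of S, so
   all the ranges below coincide. *)
have AS : (mxrange A <= mxrange S)%VS.
  apply: limg_mulmx_sub => c; apply/mem_mxrangeP; exists (S *m c).
  by rewrite mulmxA SS.
have VE : limg (linfun (mulmx V)) = mxrange S.
  by apply/eqP; rewrite eqEdim limg_mulmx_sub // (dim_limg_mulmx _ injV) /=.
have AVA : (limg (linfun (mulmx (A *m V))) <= mxrange A)%VS.
  apply: limg_mulmx_sub => c; apply/mem_mxrangeP; exists (V *m c).
  by rewrite mulmxA.
have AVE : limg (linfun (mulmx (A *m V))) = mxrange S.
  by apply/eqP; rewrite eqEdim (subv_trans AVA AS) (dim_limg_mulmx _ injAV) /=.
have AE : mxrange A = mxrange S.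
  by apply/eqP; rewrite eqEsubv AS -AVE AVA.
exists V; split=> // [x|].
  rewrite AE -VE; split=> [/memv_imgP[c _ ->]|[c ->]].
    by exists c; rewrite lfunE.
  by apply/memv_imgP; exists c; rewrite ?memvf ?lfunE.
apply: mulmx_cV_inj => x.
have /memv_imgP[c _] : A *m x \in limg (linfun (mulmx (A *m V))).
  by rewrite AVE -AE; apply/mem_mxrangeP; exists x.
rewrite lfunE /= => Ax.
have Vc : V^t* *m (A *m V *m c) = c by rewrite !mulmxA VAV mul1mx.
by rewrite -(mulmxA _ A x) Ax -(mulmxA (A *m V)) Vc.
Qed.

End AOrthonormalBasis.

(** * Simultaneous diagonalization of the pencil *)

Section Spectral.
Context {R : realType}.
Local Open Scope sesquilinear_scope.

(** The spectral theorem with the eigenvalues, which are real, put in decreasing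
    order: the columns of the diagonalizing matrix are permuted accordingly. *)
Lemma sorted_spectral {m} (M : 'M[R[i]]_m) : M \is hermsymmx ->
  exists (U : 'M[R[i]]_m) (l : m.-tuple R), [/\ U^t* *m U = 1%:M,
    sorted >=%R l & M *m U = U *m diag_mx (\row_i (tnth l i)%:C)].
Proof.
move=> Mh; pose P := spectralmx M; pose d := spectral_diag M.
have uP : P \is unitarymx := spectral_unitarymx M.
have MP : M *m P^t* = P^t* *m diag_mx d.
  have /hermitian_normalmx/orthomx_spectralP -> := Mh.
  by rewrite invmx_unitary // -!mulmxA (unitarymxP uP) mulmx1.
have dR i : d 0 i \is Num.real.
  by have /mxOverP := hermitian_spectral_diag_real Mh.
pose t := [tuple complex.Re (d 0 i) | i < m].
have /tuple_permP[s ls] : perm_eq (sort >=%R t) t by rewrite perm_sort.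
exists (col_perm s (P^t*)), [tuple of sort >=%R t]; split.
- apply/matrixP => i j; have /unitarymxP/matrixP/(_ (s i) (s j)) := uP.
  rewrite !mxE (inj_eq perm_inj) => <-; apply: eq_bigr => k _.
  by rewrite !mxE conjCK.
- by apply: sort_sorted => x y; apply: le_total.
apply/matrixP => i j; have /matrixP/(_ i (s j)) := MP.
rewrite !mul_mx_diag !mxE => e; transitivity ((P (s j) i)^* * d 0 (s j)).
  by rewrite -e; apply: eq_bigr => k _; rewrite !mxE.
congr (_ * _); rewrite (tnth_nth 0) /= ls -tnth_nth !tnth_mktuple.
by rewrite RRe_real.
Qed.

(** A unitary change of basis preserves [A]-orthonormality, so it is enough to
    diagonalize the matrix [V^t* *m (A *m T) *m V] of the compression of
    [A *m T], which is Hermitian since [A *m T] is. *)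
Lemma A_eigenbasis {n} (A T : 'M[R[i]]_n) (m := \dim (mxrange (sqrtmx A))) :
  psdmx A -> Aselfadjoint A T ->
  exists (V : 'M[R[i]]_(n, m)) (l : m.-tuple R), [/\ V^t* *m A *m V = 1%:M,
    (forall x, x \in mxrange A <-> exists c, x = V *m c),
    A *m V *m V^t* *m A = A, sorted >=%R l
    & A *m T *m V = A *m V *m diag_mx (\row_i (tnth l i)%:C)].
Proof.
move=> psdA AT; have [V [VAV VR VA]] :=
  A_orthonormal_basis A _ psdA (sqrtmxK psdA) (sqrtmx_adj A psdA).
have Hadj : (A *m T)^t* = A *m T by rewrite adjmxM (psdmx_adj A) // -AT.
have [|U [l [UU sl MU]]] := sorted_spectral (V^t* *m (A *m T) *m V).
  apply/is_hermitianmxP; rewrite expr0 scale1r.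
  by rewrite 2!adjmxM Hadj trmxCK mulmxA.
have UU' : U *m U^t* = 1%:M by apply: mulmx1C.
exists (V *m U), l; split=> //.
- rewrite adjmxM -!mulmxA (mulmxA A) (mulmxA (V^t*)) (mulmxA (V^t*)) VAV.
  by rewrite mul1mx.
- move=> x; rewrite VR; split=> -[c ->].
    by exists (U^t* *m c); rewrite -mulmxA (mulmxA U) UU' mul1mx.
  by exists (U *m c); rewrite mulmxA.
- by rewrite adjmxM -!mulmxA (mulmxA U) UU' mul1mx !mulmxA.
by rewrite -{1}VA [in RHS]mulmxA -[RHS]mulmxA -MU !mulmxA.
Qed.

End Spectral.

(** * Coordinates in an eigenbasis *)

Section EigenbasisConsequences.
Context {C : numClosedFieldType} {n m : nat}.
Local Open Scope sesquilinear_scope.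
Context (A T : 'M[C]_n) (V : 'M[C]_(n, m)) (lam : 'I_m -> C)
  (VAV : V^t* *m A *m V = 1%:M)
  (rangeV : forall x, x \in mxrange A <-> exists c, x = V *m c)
  (VA : A *m V *m V^t* *m A = A)
  (ATV : A *m T *m V = A *m V *m diag_mx (\row_i lam i))
  (psdA : psdmx A) (ATsa : Aselfadjoint A T).

Lemma AV_inj (c e : 'cV_m) : A *m V *m c = A *m V *m e -> c = e.
Proof.
move=> ce; rewrite -[c]mul1mx -[e]mul1mx -VAV -!(mulmxA (V^t*)).
by rewrite ce.
Qed.

(** The coordinates of [x] in the basis [V] are its [A]-inner products with the
    columns of [V], that is, [V^t* *m A *m x]. *)
Lemma dotA_coord (x y : 'cV_n) :
  dotA A x y = dotc (V^t* *m A *m x) (V^t* *m A *m y).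
Proof.
rewrite /dotA dotc_mx dotc_adj !adjmxM trmxCK (psdmx_adj A psdA).
by rewrite -{1}VA !mulmxA.
Qed.

Lemma dotAT_coord (x y : 'cV_n) : dotA A (T *m x) y
  = \sum_i lam i * ((V^t* *m A *m x) i 0 * ((V^t* *m A *m y) i 0)^*).
Proof.
(* Self-adjointness lets VA be inserted on the right of A *m T as well. *)
have ATE : A *m T = A *m V *m diag_mx (\row_i lam i) *m V^t* *m A.
  by rewrite ATsa -[in LHS]VA !mulmxA -ATsa ATV.
have -> : dotA A (T *m x) y
    = dotc (diag_mx (\row_i lam i) *m (V^t* *m A *m x)) (V^t* *m A *m y).
  rewrite /dotA mulmxA ATE -!mulmxA dotc_mx dotc_adj.
  by rewrite !adjmxM trmxCK (psdmx_adj A psdA) !mulmxA.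
rewrite dotcE; apply: eq_bigr => i _.
by rewrite mul_diag_mx mxE mulrA; congr (_ * _ * _); rewrite mxE.
Qed.

(** [A *m V] is injective, so the eigenvector equation can be read off
    coordinate by coordinate. *)
Lemma Aeigen_coord z (c : 'cV_m) :
  (A *m (T *m (V *m c)) == z *: (A *m (V *m c)))
    = [forall i, (lam i == z) || (c i 0 == 0)].
Proof.
have -> : A *m (T *m (V *m c)) = A *m V *m (diag_mx (\row_i lam i) *m c).
  by rewrite !mulmxA ATV.
have -> : z *: (A *m (V *m c)) = A *m V *m (z *: c).
  by rewrite mulmxA scalemxAr.
apply/eqP/forallP => [/AV_inj/matrixP e i|ez].
  have := e i 0; rewrite mul_diag_mx !mxE => /eqP.
  by rewrite -subr_eq0 -mulrBl mulf_eq0 subr_eq0.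
congr (_ *m _); apply/matrixP => i j; rewrite ord1 mul_diag_mx !mxE.
by case/orP: (ez i) => /eqP ->; rewrite ?mulr0.
Qed.

Lemma Aeigenvalues_basis :
  Aeigenvalues A T = [set z | exists i, z = lam i]%classic.
Proof.
apply/seteqP; split=> z /=.
  move=> [x [/rangeV[c ->] x0 /eqP]]; rewrite Aeigen_coord => /forallP cz.
  have [i ci|c0] := pickP (fun i => c i 0 != 0).
    by exists i; apply/esym/eqP; move: (cz i); rewrite (negPf ci) orbF.
  case/eqP: x0; rewrite (_ : c = 0) ?mulmx0 //.
  by apply/matrixP => i j; rewrite ord1 mxE; have /negbFE/eqP := c0 i.
move=> [i ->]; exists (V *m delta_mx i 0); split.
- by apply/rangeV; exists (delta_mx i 0).
- apply/eqP => Vd; have : A *m V *m delta_mx i 0 = A *m V *m 0 :> 'cV_n.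
    by rewrite -mulmxA Vd !mulmx0.
  by move/AV_inj/matrixP/(_ i 0)/eqP; rewrite !mxE !eqxx oner_eq0.
apply/eqP; rewrite Aeigen_coord; apply/forallP => j; rewrite !mxE.
by have [->|] := eqVneq j i; rewrite ?eqxx ?orbT.
Qed.

(** The columns of [V] that are eigenvectors for [z] span the eigenspace, and
    they are free as a subfamily of a free one. *)
Lemma Amultiplicity_basis z : Amultiplicity A T z
  = count (fun i => lam i == z) (enum 'I_m).
Proof.
pose b := [tuple col i V | i < m].
have bE (i : 'I_m) : b`_i = col i V by rewrite -tnth_nth tnth_mktuple.
have freeb : free b.
  apply/freeP => k k0 i.
  have : A *m V *m (\col_i k i) = A *m V *m 0.
    rewrite -mulmxA mulmx0 (_ : V *m _ = 0) ?mulmx0 // -[RHS]k0.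
    apply/matrixP => r j; rewrite ord1 mxE summxE; apply: eq_bigr => l _.
    by rewrite bE !mxE mulrC.
  by move/AV_inj/matrixP/(_ i 0); rewrite !mxE.
pose eig (v : 'cV[C]_n) := A *m (T *m v) == z *: (A *m v).
have eigb i : eig (col i V) = (lam i == z).
  rewrite /eig colE Aeigen_coord; apply/forallP/idP => [/(_ i)|li j].
    by rewrite !mxE !eqxx oner_eq0 orbF.
  by rewrite !mxE; have [->|] := eqVneq j i; rewrite ?li ?eqxx ?orbT.
have spanE : Aeigenspace A T z = <<filter eig b>>%VS.
  apply/eqP; rewrite eqEsubv; apply/andP; split.
    apply/subvP => x; rewrite mem_AeigenspaceE => /andP[/rangeV[c ->]].
    rewrite Aeigen_coord => /forallP cz.
    have -> : V *m c = \sum_i c i 0 *: col i V.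
      apply/matrixP => r j; rewrite ord1 mxE summxE; apply: eq_bigr => l _.
      by rewrite !mxE mulrC.
    apply: memv_suml => i _; case/orP: (cz i) => [li|/eqP ->]; last first.
      by rewrite scale0r mem0v.
    apply/memvZ/memv_span; rewrite mem_filter eigb li /=.
    by rewrite -bE mem_nth ?size_tuple.
  apply/span_subvP => v; rewrite mem_filter => /andP[ev /(nthP 0)[k]].
  rewrite size_tuple => km vk; pose i := Ordinal km.
  have vi : v = col i V by rewrite -bE -vk.
  rewrite mem_AeigenspaceE -/(eig v) ev andbT; apply/rangeV.
  by exists (delta_mx i 0); rewrite vi colE.
have /eqP dimE := filter_free eig freeb.
rewrite /Amultiplicity spanE dimE size_filter count_map.
by apply: eq_count => i /=; rewrite eigb.
Qed.

Lemma Aqnumrange_basis q : Aqnumrange q A T = [set z | exists c e : 'cV[C]_m,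
    [/\ dotc c c = 1, dotc e e = 1, dotc c e = q
      & z = \sum_i lam i * (c i 0 * (e i 0)^*)]]%classic.
Proof.
have norm1 x : (normA A x = 1) <-> dotA A x x = 1.
  rewrite /normA; split=> [x1|->]; last exact: sqrtC1.
  by rewrite -[LHS]sqrtCK x1 expr1n.
apply/seteqP; split=> z /=.
  move=> [x [y [/norm1 + /norm1 + + ->]]]; rewrite dotAT_coord !dotA_coord.
  by move=> xx yy xy; exists (V^t* *m A *m x), (V^t* *m A *m y).
move=> [c [e [cc ee ce ->]]]; exists (V *m c), (V *m e).
have K (d : 'cV_m) : V^t* *m A *m (V *m d) = d by rewrite mulmxA VAV mul1mx.
rewrite dotAT_coord dotA_coord !K; split=> //; apply/norm1.
all: by rewrite dotA_coord K.
Qed.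

End EigenbasisConsequences.

Theorem theorem2p4 (R : realType) (n m : nat) (q : R[i]) (A T : 'M[R[i]]_n)
    (hq : `|q| <= 1) (hA : psdmx A) (hm : m = \dim (mxrange (sqrtmx A)))
    (hm2 : (2 <= m)%N) (hmn : (m <= n)%N) (hT : Aselfadjoint A T) :
  exists l : m.-tuple R,
    [/\ sorted >=%R l,
        Aeigenvalues A T = [set z | exists2 x : R, x \in l & z = x%:C]%classic,
        forall z : R[i],
          Amultiplicity A T z = count_mem z [seq x%:C | x <- l]
      & Aqnumrange q A T =
          elliptic_disk (q * (l`_0)%:C) (q * (l`_m.-1)%:C)
            (sqrtC (1 - `|q| ^+ 2) * (l`_0 - l`_m.-1)%:C)].
Proof.
have := A_eigenbasis A T hA hT; rewrite -hm => -[V [l]].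
move=> [VAV rangeV VA sl ATV]; exists l; split=> //.
- rewrite (Aeigenvalues_basis _ _ _ (fun i => (tnth l i)%:C) VAV rangeV ATV).
  apply/seteqP; split=> z /= [k].
    by move=> ->; exists (tnth l k); rewrite ?mem_tnth.
  by move=> /tnthP[j ->] ->; exists j.
- move=> z.
  rewrite (Amultiplicity_basis _ _ _ (fun i => (tnth l i)%:C) VAV rangeV ATV).
  by rewrite -[in RHS](map_tnth_enum l) !count_map.
pose i0 : 'I_m := Ordinal (leq_trans (isT : 0 < 2)%N hm2).
have lt1 : (m.-1 < m)%N by rewrite prednK // (leq_trans _ hm2).
pose i1 : 'I_m := Ordinal lt1.
pose lam i := (tnth l i)%:C.
have lamP i : lam i1 <= lam i <= lam i0.
  have le_l (j k : 'I_m) : (j <= k)%N -> lam k <= lam j.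
    move=> jk; rewrite lecR !(tnth_nth 0).
    have ge_trans : transitive (>=%R : rel R).
      by move=> y x z yx zy; exact: le_trans zy yx.
    apply: (sorted_leq_nth ge_trans (fun _ => le_refl _) 0 sl) => //.
      by rewrite inE size_tuple.
    by rewrite inE size_tuple.
  by rewrite !le_l //= -ltnS prednK // (leq_trans _ hm2).
have -> : l`_0 = tnth l i0 by rewrite (tnth_nth 0).
have -> : l`_m.-1 = tnth l i1 by rewrite (tnth_nth 0).
rewrite rmorphB elliptic_diskE //; last by case/andP: (lamP i0).
rewrite (Aqnumrange_basis _ _ _ lam VAV VA ATV hA hT).
have i01 : i0 != i1.
  by rewrite -val_eqE /= ltn_eqF // -ltnS prednK // (leq_trans _ hm2).
by apply/seteqP; split=> z /= /(diag_qnumrange lam i0 i1 q z hq i01 lamP).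
Qed.
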